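(* Let $(\gamma_h)_{h\in\mathbb N^*}$ be defined by $\gamma_{2h}=(2h-1)^{-1/2}$ and $\gamma_{2h+1}=\bigl[2h\bigl(1-\frac1{(2h+1)^2}\bigr)\bigr]^{-1/2}$. Let $\mathbb P$ be a partially exchangeable probability distribution on $\Omega=(\mathbb R^d\times\{-1,+1\})^{(k+1)N}$ and $\epsilon\in(0,1)$. With $\mathbb P$ probability at least $1-\epsilon$, for any $(w,b)\in\Theta=\{(w,b)\in\mathbb R^d\times\mathbb R:\|w\|=1\}$, $$\begin{aligned}&\frac1{kN}\sum_{i=N+1}^{(k+1)N}\mathbf 1\bigl\{2\,\mathbf 1[g_{w,b}(X_i)\ge0]-1\ne Y_i\bigr\}\\&\le\inf_{\lambda\in\mathbb R_+,\,h\in\mathbb N^*}\Biggl(\frac{k+1}k\bigl[1-\exp(-\tfrac\lambda N)\bigr]^{-1}\Biggl\{1-\exp\Biggl[-\frac\lambda{N^2}\sum_{i=1}^N\mathbf 1[g_{w,b}(X_i)Y_i\le4R\gamma_h]\\&\qquad-\frac{\log[20(k+1)N]\Bigl\{\frac h{\log(2)}\log\Bigl(\frac{4e(k+1)N}h\Bigr)+1\Bigr\}+\log\Bigl[\frac{2h(h+1)}\epsilon\Bigr]}N\Biggr]\Biggr\}-\frac1{kN}\sum_{i=1}^N\mathbf 1[g_{w,b}(X_i)Y_i\le4R\gamma_h]\Biggr).\end{aligned}$$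
   Context: $N,k,d\ge1$ are fixed integers; $(X_i,Y_i)_{i=1}^{(k+1)N}$ is the coordinate process on $\Omega$, with $X_i\in\mathbb R^d$ and $Y_i\in\{-1,+1\}$. $g_{w,b}(x)=\langle w,x\rangle-b$ and $R=\max\{\|X_i\|:1\le i\le(k+1)N\}$. For $h=1$ the convention is $\gamma_1=+\infty$. The infimum in $\lambda$ is over $\lambda>0$. Partial exchangeability: for $i=1,\dots,N$ let $\tau_i:\Omega\to\Omega$ be the map performing a circular permutation of the $k+1$ coordinates $\omega_i,\omega_{i+N},\dots,\omega_{i+kN}$ (i.e. $\tau_i(\omega)_{i+jN}=\omega_{i+(j-1)N}$ for $j=1,\dots,k$, $\tau_i(\omega)_i=\omega_{i+kN}$) and leaving the other coordinates unchanged; $\mathbb P$ is partially exchangeable if $\mathbb P\circ\tau_i^{-1}=\mathbb P$ for all $i=1,\dots,N$.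
   Formalization: The infimum over h in N* is restricted to 1 ≤ h ≤ 4(k+1)N, because as h→∞ the term h·log(4e(k+1)N/h) tends to −∞, so the printed right-hand side is −∞ and the inequality over all h is false. *)

(* Defs.v *)
(* World: MathComp / MathComp-Analysis. *)
From HB Require Import structures.
From mathcomp Require Import all_boot all_order all_algebra.
From mathcomp Require Import all_classical all_reals all_analysis.

Set Implicit Arguments.
Unset Strict Implicit.
Unset Printing Implicit Defensive.

Import Order.TTheory GRing.Theory Num.Theory.

Local Open Scope classical_set_scope.
Local Open Scope ring_scope.

(** Indices are 0-based: the paper's i in {1,...,(k+1)N} is i - 1 : 'I_(k.+1 * N),
    so that the first (labelled) sample is [i < N] and the test sample is [N <= i].
    A label is a boolean, [true] for +1 and [false] for -1. *)

(* Omega = (R^d x {-1,+1})^((k+1)N), with the library's product sigma-algebra. *)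
Notation Omega R N k d :=
  ((k.+1 * N).-tuple (d.-tuple (measurableTypeR R) * bool)%type).

Section Exchangeability.
Variables (R : realType) (N k d : nat).

(* [insubd] never takes its default value [l] here: both candidate indices are
   smaller than (k+1)N. *)
Definition tau_index (i : 'I_N) (l : 'I_(k.+1 * N)) : 'I_(k.+1 * N) :=
  if (l %% N == i)%N
  then insubd l (if (l < N)%N then l + k * N else l - N)%N
  else l.

Definition tau (i : 'I_N) (omega : Omega R N k d) : Omega R N k d :=
  [tuple tnth omega (tau_index i l) | l < k.+1 * N].

Definition partially_exchangeable (P : probability (Omega R N k d) R) : Prop :=
  forall (i : 'I_N) (A : set (Omega R N k d)),
    measurable A -> P (tau i @^-1` A) = P A.

End Exchangeability.

Section Margin.
Variables (R : realType) (N k d : nat).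
Implicit Types (omega : Omega R N k d) (w x : d.-tuple R) (b lambda eps : R).

Definition dotp w x : R := \sum_(j < d) tnth w j * tnth x j.

(* Euclidean norm; the library's norm on row vectors is the sup norm. *)
Definition enorm x : R := Num.sqrt (\sum_(j < d) tnth x j ^+ 2).

Definition X omega (i : 'I_(k.+1 * N)) : d.-tuple R := (tnth omega i).1.

Definition Y omega (i : 'I_(k.+1 * N)) : R :=
  if (tnth omega i).2 then 1 else -1.

Definition g w b x : R := dotp w x - b.

Definition radius omega : R :=
  \big[Num.max/0]_(i < k.+1 * N) enorm (X omega i).

(* For h = 2j the formula reads (2j-1)^(-1/2), for h = 2j+1 it reads
   [2j (1 - 1/(2j+1)^2)]^(-1/2); both involve h - 1. Only h >= 1 is meaningful. *)
Definition gamma (h : nat) : \bar R :=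
  if (h <= 1)%N then +oo%E
  else if odd h
  then ((Num.sqrt (h.-1%:R * (1 - (h%:R ^+ 2)^-1)))^-1)%:E
  else ((Num.sqrt h.-1%:R)^-1)%:E.

(* 4 R gamma_h. It is +oo when gamma_h is, including when R = 0 (the library's
   product would give 0 * +oo = 0). *)
Definition margin omega (h : nat) : \bar R :=
  if gamma h is c%:E then (4 * radius omega * c)%:E else +oo%E.

Definition test_error w b omega : R :=
  (k%:R * N%:R)^-1 *
  \sum_(i < k.+1 * N | (N <= i)%N)
    (2 * (0 <= g w b (X omega i))%R%:R - 1 != Y omega i)%:R.

Definition margin_errors w b (h : nat) omega : R :=
  \sum_(i < k.+1 * N | (i < N)%N)
    ((g w b (X omega i) * Y omega i)%:E <= margin omega h)%E%:R.

(* With n = (k+1)N, the term h ln(4en/h) increases for h <= 4n, where it bounds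
   ln (\sum_(i <= h) 'C(n, i) 4^i). Beyond 4n it decreases, with limit -oo, and
   it no longer controls anything: the theorem is stated for 1 <= h <= 4n. *)
Definition complexity eps (h : nat) : R :=
  let n := k.+1%:R * N%:R in
  ln (20 * n) * (h%:R / ln 2 * ln (4 * expR 1 * n / h%:R) + 1)
  + ln (2 * h%:R * h.+1%:R / eps).

Definition margin_bound eps w b lambda (h : nat) omega : R :=
  k.+1%:R / k%:R * (1 - expR (- (lambda / N%:R)))^-1 *
  (1 - expR (- (lambda / N%:R ^+ 2) * margin_errors w b h omega
             - complexity eps h / N%:R))
  - (k%:R * N%:R)^-1 * margin_errors w b h omega.

End Margin.

(* Main.v *)
(** Discretize [x |-> <w, x> - b] on the [(k+1)N] points of a sample into six
    cells with edges [0], [2 R gamma_h] and [4 R gamma_h] in absolute value. A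
    maximal family of such discretizations that pairwise differ by two cells
    somewhere is a net for the others, and its size is polynomial in the number
    of points because a larger family would shatter [h] points with margin
    [R gamma_h], which averaging [|sum_i a_i x_i|^2] over the permutations of
    balanced coefficients [a] rules out. For a fixed element of the net, the
    numbers of training errors along an orbit of the shifts [tau_i] have an
    exponential moment bounded by that of independent sampling, so that a union
    bound over the net limits the proportion of bad points in each orbit, hence
    the probability of the bad event. Hyperplanes with rational coefficients
    suffice, which makes that event measurable. *)
Require Import Defs.
From HB Require Import structures.
From mathcomp Require Import all_boot all_order all_algebra all_fingroup.
From mathcomp Require Import ring lra.

Set Implicit Arguments.
Unset Strict Implicit.
Unset Printing Implicit Defensive.

Import Order.TTheory GRing.Theory Num.Theory.

Local Open Scope ring_scope.

Section Shattering.
Local Open Scope nat_scope.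
Variables (T : finType) (b : nat).
Implicit Types (F G : {set {ffun T -> 'I_b.+2}}) (p : {ffun T -> 'I_b.+1}).

Definition far (f g : {ffun T -> 'I_b.+2}) := [exists i, (f i + 2 <= g i) || (g i + 2 <= f i)].

Definition separated F := forall f g, f \in F -> g \in F -> f != g -> far f g.

(* The value [ord0] of a pattern [p] marks the points outside its support. *)
Definition shatters F p := [forall s : {ffun T -> bool}, exists f in F,
  [forall i, (p i != ord0) ==> (if s i then p i < f i else f i < p i)]].

Definition shattered F := [set p | shatters F p].

Definition fiber F i v := [set f in F | f i == v].

Lemma shattersS F G p : F \subset G -> shatters F p -> shatters G p.
Proof.
move=> FG /forallP sF; apply/forallP => s; have /exists_inP[f fF fs] := sF s.
by apply/exists_inP; exists f => //; apply: (subsetP FG).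
Qed.

Lemma fiber_sub F i v : fiber F i v \subset F.
Proof. by apply/subsetP => f; rewrite inE => /andP[]. Qed.

Lemma separatedS F G : F \subset G -> separated G -> separated F.
Proof. by move=> /subsetP FG sG f g /FG fG /FG gG; apply: sG. Qed.

Lemma shatters_fiber F i v p : shatters (fiber F i v) p -> p i = ord0.
Proof.
move=> /forallP sF; apply/eqP/negPn/negP => pi0.
have /exists_inP[f] := sF [ffun _ => true]; rewrite inE => /andP[_ /eqP fi].
move=> /forallP/(_ i); rewrite pi0 ffunE /= fi => lt1.
have /exists_inP[g] := sF [ffun _ => false]; rewrite inE => /andP[_ /eqP gi].
move=> /forallP/(_ i); rewrite pi0 ffunE /= gi => lt2.
by have := ltn_trans lt1 lt2; rewrite ltnn.
Qed.

Lemma shattered_step F i (u v : 'I_b.+2) : u + 2 <= v ->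
  #|shattered (fiber F i u)| + #|shattered (fiber F i v)| <= #|shattered F|.
Proof.
move=> uv; set S := shattered _; set S' := shattered _.
have tb : u.+1 < b.+1 by have := leq_ltn_trans uv (ltn_ord v); rewrite addn2 !ltnS.
pose t : 'I_b.+1 := Ordinal tb.
pose upd p : {ffun T -> 'I_b.+1} := [ffun j => if j == i then t else p j].
have supp0 p : p \in S :|: S' -> p i = ord0.
  by rewrite !inE => /orP[] /shatters_fiber.
have injupd : {in S :&: S' &, injective upd}.
  move=> p q; rewrite !inE => /andP[/shatters_fiber pi _] /andP[/shatters_fiber qi _] e.
  apply/ffunP => j; have := congr1 (fun z : {ffun _} => z j) e; rewrite !ffunE.
  by case: eqP => // ->; rewrite pi qi.
rewrite -cardsUI -(card_in_imset injupd).
have dis : [disjoint S :|: S' & upd @: (S :&: S')].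
  rewrite disjoints_subset; apply/subsetP => p /supp0 pi; rewrite inE; apply/negP.
  by case/imsetP => q _ pE; move: pi; rewrite pE ffunE eqxx.
rewrite -[X in _ <= X](cardsID (S :|: S')) leq_add //; apply: subset_leq_card.
  apply/subsetP => p pS; rewrite inE pS andbT inE; move: pS; rewrite !inE => /orP[];
  exact/shattersS/fiber_sub.
apply/subsetP => p' p'S; rewrite inE; apply/andP; split.
  by apply/negP => h; rewrite (disjointFr dis h) in p'S.
move: p'S => /imsetP[p pS ->]; rewrite inE; apply/forallP => s.
move: pS; rewrite !inE => /andP[/forallP/(_ s)/exists_inP[f fF /forallP fs]].
move=> /forallP/(_ s)/exists_inP[g gF /forallP gs].
move: fF gF; rewrite !inE => /andP[fF /eqP fi] /andP[gF /eqP gi].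
apply/exists_inP; exists (if s i then g else f); first by case: ifP.
apply/forallP => j; rewrite ffunE; case: (j =P i) => [->|_]; last first.
  by case: (s i); [apply: gs | apply: fs].
apply/implyP => _; case: (s i); rewrite ?fi ?gi //=.
by move: uv; rewrite addn2.
Qed.

Lemma card_low_fibers F m : 0 < m ->
  #|[set f in F | [exists i, #|fiber F i (f i)| < m]]| + #|T| * b.+2 <= #|T| * b.+2 * m.
Proof.
move=> m0.
have -> : #|T| * b.+2 = \sum_(x : T * 'I_b.+2) 1.
  by rewrite sum1_card card_prod card_ord.
have le : #|[set f in F | [exists i, #|fiber F i (f i)| < m]]| <=
    \sum_(x : T * 'I_b.+2) m.-1.
  apply: (@leq_trans #|\bigcup_(x : T * 'I_b.+2 | #|fiber F x.1 x.2| < m) fiber F x.1 x.2|).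
    apply/subset_leq_card/subsetP => f; rewrite inE => /andP[fF /existsP[i lti]].
    by apply/bigcupP; exists (i, f i) => //; rewrite inE fF /=.
  apply: (@leq_trans (\sum_(x : T * 'I_b.+2 | #|fiber F x.1 x.2| < m) #|fiber F x.1 x.2|)).
    elim/big_rec2: _ => [|x A C _ IH]; first by rewrite cards0.
    by rewrite (leq_trans (leq_card_setU _ _)) // leq_add2l.
  rewrite big_mkcond; apply: leq_sum => x _; case: ifP => //.
  by case: m m0 => // m _.
apply: leq_trans (leq_add le (leqnn _)) _.
by rewrite -big_split big_distrl /=; apply: leq_sum => x _; rewrite mul1n addn1 prednK.
Qed.

Lemma shattered_exp F r : 0 < #|T| -> separated F ->
  (#|T| * b.+2) ^ r <= #|F| -> 2 ^ r <= #|shattered F|.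
Proof.
move=> T0; elim: r F => [|r IH] F sF leF.
  rewrite expn0 card_gt0; apply/set0Pn; exists [ffun _ => ord0]; rewrite inE.
  have /set0Pn[f fF] : F != set0 by rewrite -card_gt0.
  by apply/forallP => s; apply/exists_inP; exists f => //; apply/forallP => i; rewrite ffunE.
have m0 : 0 < (#|T| * b.+2) ^ r by rewrite expn_gt0 muln_gt0 T0.
have := card_low_fibers F m0; set D := [set f in F | _]; rewrite -expnS => leD.
have two : 1 < #|F :\: D|.
  have : #|T| * b.+2 <= #|F :\: D|.
    have DF : D \subset F by apply/subsetP => f; rewrite inE => /andP[].
    rewrite cardsD (setIidPr DF) leq_subRL; last exact: subset_leq_card.
    exact: leq_trans leD leF.
  by apply: leq_trans; rewrite -[X in X <= _]mul1n leq_mul.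
case/card_gt1P : two => f [g] [].
rewrite !inE => /andP[Df fF] /andP[Dg gF] fg.
have bigfib f0 : f0 \in F -> ~~ ((f0 \in F) && [exists i, #|fiber F i (f0 i)| < (#|T| * b.+2) ^ r]) ->
  forall i, 2 ^ r <= #|shattered (fiber F i (f0 i))|.
  move=> -> /=; rewrite negb_exists => /forallP h i; apply: IH; last by rewrite leqNgt.
  exact: separatedS (fiber_sub _ _ _) sF.
have bf := bigfib _ fF Df; have bg := bigfib _ gF Dg.
have /existsP[i /orP[] le] := sF _ _ fF gF fg;
  apply: leq_trans (shattered_step F i le);
  by rewrite expnS mul2n -addnn leq_add.
Qed.

End Shattering.

Definition small_patterns (T : finType) (b h : nat) :=
  [set p : {ffun T -> 'I_b.+1} | (#|[set i | p i != ord0]| <= h)%N].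

Lemma small_patternsS (T : finType) (b h h' : nat) : (h <= h')%N ->
  small_patterns T b h \subset small_patterns T b h'.
Proof. by move=> hh; apply/subsetP => p; rewrite !inE => /leq_trans; apply. Qed.

Lemma card_small_patterns (R : realFieldType) (T : finType) (b h : nat) (x : R) :
  0 < x -> x <= 1 ->
  #|small_patterns T b h|%:R * x ^+ h
    <= (1 + b%:R * x) ^+ #|T|.
Proof.
move=> x0 x1.
have -> : (1 + b%:R * x) ^+ #|T| =
    \sum_(p : {ffun T -> 'I_b.+1}) x ^+ #|[set i | p i != ord0]|.
  transitivity (\prod_(i : T) \sum_(j : 'I_b.+1) (if j != ord0 then x else 1)).
    rewrite prodr_const big_ord_recl /=; congr (_ ^+ _); congr (_ + _).
    by rewrite sumr_const card_ord mulr_natl.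
  rewrite bigA_distr_bigA; apply: eq_bigr => p _.
  by rewrite -big_mkcond /= -prodr_const; apply: eq_bigl => i; rewrite inE.
rewrite -sum1_card natr_sum mulr_suml big_mkcond /=; apply: ler_sum => p _.
rewrite inE; case: ifP => le; last exact/exprn_ge0/ltW.
by rewrite mul1r; apply: ler_wiXn2l => //; apply: ltW.
Qed.

Section Averaging.
Variables (R : realFieldType) (h d : nat).
Implicit Types (a : 'I_h.+2 -> R) (x : 'I_h.+2 -> 'I_d -> R) (s : {perm 'I_h.+2}).

Definition perm_corr a i j : R := \sum_(s : {perm 'I_h.+2}) a (s i) * a (s j).

Lemma perm_corrM a (t : {perm 'I_h.+2}) i j : perm_corr a (t i) (t j) = perm_corr a i j.
Proof.
rewrite /perm_corr (reindex_inj (mulgI t^-1%g)) /=; apply: eq_bigr => s _.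
by rewrite !permM !permK.
Qed.

Lemma perm_corr_diag a i :
  h.+2%:R * perm_corr a i i = (h.+2)`!%:R * \sum_i a i ^+ 2.
Proof.
have diag j : perm_corr a j j = perm_corr a i i.
  by rewrite -(perm_corrM a (tperm i j)) tpermR.
transitivity (\sum_(j < h.+2) perm_corr a j j).
  rewrite (eq_bigr (fun=> perm_corr a i i)) => [|j _]; last exact: diag.
  by rewrite sumr_const card_ord mulr_natl.
rewrite /perm_corr exchange_big /= (eq_bigr (fun=> \sum_i a i ^+ 2)) => [|s _].
  by rewrite sumr_const card_Sn mulr_natl.
rewrite [RHS](reindex_inj (@perm_inj _ s)) /=; apply: eq_bigr => j _.
by rewrite expr2.
Qed.

Lemma perm_corr_off a i j : \sum_i a i = 0 -> i != j ->
  h.+1%:R * perm_corr a i j = - perm_corr a i i.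
Proof.
move=> a0 ij.
have off l : l != i -> perm_corr a i l = perm_corr a i j.
  move=> li; rewrite -(perm_corrM a (tperm j l)) tpermR.
  by rewrite tpermD // eq_sym.
have : \sum_l perm_corr a i l = 0.
  rewrite exchange_big /= big1 // => s _; rewrite -mulr_sumr.
  by rewrite -[X in _ * X](reindex_inj (@perm_inj _ s) (P := predT) (F := a)) a0 mulr0.
rewrite (bigD1 i) //= (eq_bigr (fun=> perm_corr a i j)) => [|l li]; last exact: off.
rewrite sumr_const cardC1 card_ord /= => e.
by apply/eqP; rewrite mulr_natl -addr_eq0 addrC e.
Qed.

Lemma sum_perm_sqr a x : \sum_i a i = 0 ->
  (h.+2 * h.+1)%:R * \sum_(s : {perm 'I_h.+2}) \sum_j (\sum_i a (s i) * x i j) ^+ 2 =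
  (h.+2)`!%:R * (\sum_i a i ^+ 2) *
    (h.+2%:R * \sum_i \sum_j x i j ^+ 2 - \sum_j (\sum_i x i j) ^+ 2).
Proof.
move=> a0.
have expand : \sum_(s : {perm 'I_h.+2}) \sum_j (\sum_i a (s i) * x i j) ^+ 2 =
    \sum_j \sum_i \sum_l perm_corr a i l * (x i j * x l j).
  rewrite exchange_big /=; apply: eq_bigr => j _.
  transitivity (\sum_(s : {perm 'I_h.+2}) \sum_i \sum_l (a (s i) * a (s l)) * (x i j * x l j)).
    apply: eq_bigr => s _; rewrite expr2 mulr_suml; apply: eq_bigr => i _.
    by rewrite mulr_sumr; apply: eq_bigr => l _; ring.
  rewrite exchange_big; apply: eq_bigr => i _; rewrite exchange_big /=.
  by apply: eq_bigr => l _; rewrite mulr_suml.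
set A := (h.+2)`!%:R * _.
have corr i l : (h.+2 * h.+1)%:R * perm_corr a i l = A * ((i == l)%:R * h.+2%:R - 1).
  rewrite natrM; case: eqVneq => [<-|il].
    by rewrite mulrAC perm_corr_diag -/A mulr1n mul1r -[h.+2%:R]natr1 addrK.
  rewrite -mulrA perm_corr_off // mulrN perm_corr_diag -/A mulr0n mul0r sub0r.
  by rewrite mulrN1.
rewrite expand mulr_sumr [X in _ = A * (_ * X - _)]exchange_big /= mulr_sumr.
rewrite -sumrB mulr_sumr; apply: eq_bigr => j _.
transitivity (\sum_i \sum_l A * ((i == l)%:R * h.+2%:R - 1) * (x i j * x l j)).
  rewrite mulr_sumr; apply: eq_bigr => i _; rewrite mulr_sumr; apply: eq_bigr => l _.
  by rewrite mulrA corr.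
rewrite expr2 mulr_suml mulr_sumr -sumrB mulr_sumr; apply: eq_bigr => i _.
transitivity (\sum_l (A * ((i == l)%:R * h.+2%:R * (x i j * x l j)) - A * (x i j * x l j))).
  by apply: eq_bigr => l _; ring.
rewrite sumrB -!mulr_sumr -mulrBr; congr (A * (_ - _)).
rewrite (bigD1 i) //= eqxx big1 ?addr0 => [|l li]; first by rewrite mul1r expr2.
by rewrite eq_sym (negbTE li) !mul0r.
Qed.

Lemma exists_perm_small a x (rho2 : R) : \sum_i a i = 0 ->
  (forall i, \sum_j x i j ^+ 2 <= rho2) ->
  exists s : {perm 'I_h.+2}, h.+1%:R * \sum_j (\sum_i a (s i) * x i j) ^+ 2 <=
    (\sum_i a i ^+ 2) * h.+2%:R * rho2.
Proof.
move=> a0 xr; apply/existsP; apply: contraT; rewrite negb_exists => /forallP big.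
have a2 : 0 <= \sum_i a i ^+ 2 by apply: sumr_ge0 => i _; exact: sqr_ge0.
pose B := (\sum_i a i ^+ 2) * h.+2%:R * rho2.
have lt : \sum_(s : {perm 'I_h.+2}) B < \sum_(s : {perm 'I_h.+2}) h.+1%:R * \sum_j (\sum_i a (s i) * x i j) ^+ 2.
  apply: ltr_sum => [|s _]; last by rewrite ltNge.
  by apply/hasP; exists 1%g; rewrite ?mem_index_enum.
move: lt; rewrite sumr_const card_Sn -[X in X < _]mulr_natl -[X in _ < X]mulr_sumr.
rewrite -(@ltr_pM2l _ h.+2%:R) ?ltr0n // [X in _ < X]mulrA -[X in X * \sum__ _]natrM sum_perm_sqr //.
rewrite ltNge => /negP[].
apply: (@le_trans _ _ ((h.+2)`!%:R * (\sum_i a i ^+ 2) * (h.+2%:R * (h.+2%:R * rho2)))).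
  apply: ler_wpM2l; first by rewrite mulr_ge0.
  rewrite lerBlDr ler_wpDr // ?sumr_ge0 // => [j _|]; first exact: sqr_ge0.
  rewrite ler_wpM2l // (_ : h.+2%:R * rho2 = \sum_(i < h.+2) rho2) ?ler_sum //.
  by rewrite sumr_const card_ord mulr_natl.
by rewrite /B le_eqVlt; apply/orP; left; apply/eqP; ring.
Qed.

End Averaging.

Section MarginShattering.
Variables (R : realFieldType) (I : finType) (d : nat).
Variables (x : I -> 'I_d -> R) (t : I -> R) (c : R).

Definition margin_shattered := forall s : I -> bool, exists (w : 'I_d -> R) (b : R),
  \sum_j w j ^+ 2 <= 1 /\ forall i, let v := \sum_j w j * x i j - b in
    if s i then t i + c <= v else v < t i - c.

Lemma margin_shattered_comb (a : I -> R) : 0 <= c -> margin_shattered ->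
  \sum_i a i = 0 -> \sum_i `|a i| = 2 -> (forall i, a i != 0) ->
  4 * c ^+ 2 < \sum_j (\sum_i a i * x i j) ^+ 2.
Proof.
move=> c0 sh; wlog at0 : a / 0 <= \sum_i a i * t i => [wl a0 an aN|].
  have [|neg] := leP 0 (\sum_i a i * t i); first by move=> ?; apply: wl.
  have E j : \sum_i - a i * x i j = - \sum_i a i * x i j.
    by rewrite -sumrN; apply: eq_bigr => i _; rewrite mulNr.
  have := wl (fun i => - a i); under [X in _ < X]eq_bigr => j _ do rewrite E sqrrN.
  apply.
  - rewrite -[X in _ <= X](_ : - \sum_i a i * t i = _) ?oppr_ge0 ?ltW //.
    by rewrite -sumrN; apply: eq_bigr => i _; rewrite mulNr.
  - by rewrite sumrN a0 oppr0.
  - by rewrite -an; apply: eq_bigr => i _; rewrite normrN.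
  - by move=> i; rewrite oppr_eq0.
move=> a0 an aN; have [w [b [w1 wx]]] := sh (fun i => 0 < a i).
set v := fun j => \sum_i a i * x i j.
set L := \sum_j w j * v j.
have LE : L = \sum_i a i * (\sum_j w j * x i j - b).
  under [RHS]eq_bigr => i _ do rewrite mulrBr mulr_sumr.
  rewrite sumrB -mulr_suml a0 mul0r subr0 exchange_big /=; apply: eq_bigr => j _.
  by rewrite mulr_sumr; apply: eq_bigr => i _; ring.
have [i0 ai0] : exists i, a i < 0.
  apply/existsP; apply: contraT; rewrite negb_exists => /forallP pos.
  have : \sum_i `|a i| = 0.
    by rewrite -[RHS]a0; apply: eq_bigr => i _; rewrite ger0_norm // leNgt.
  by rewrite an => /eqP; rewrite pnatr_eq0.
have term i : a i * t i + `|a i| * c <= a i * (\sum_j w j * x i j - b).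
  have := wx i => /=; case: ltrgt0P (aN i) => // ai _; nra.
have L2 : 2 * c < L.
  apply: (@le_lt_trans _ _ (\sum_i (a i * t i + `|a i| * c))).
    by rewrite big_split /= -mulr_suml an ler_wpDl.
  rewrite LE (bigD1 i0) //= [X in _ < X](bigD1 i0) //= ltr_leD ?ler_sum //.
  have := wx i0; rewrite /= ltNge ltW //= ltr0_norm // => lt; nra.
have : 0 <= \sum_j (v j - L * w j) ^+ 2 by apply: sumr_ge0 => j _; exact: sqr_ge0.
have -> : \sum_j (v j - L * w j) ^+ 2 =
    \sum_j v j ^+ 2 - 2 * L * L + L ^+ 2 * \sum_j w j ^+ 2.
  have -> : 2 * L * L = \sum_j 2 * L * (w j * v j) by rewrite -mulr_sumr.
  rewrite mulr_sumr -sumrB -big_split /=.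
  by apply: eq_bigr => j _; ring.
have := sqr_ge0 L; nra.
Qed.

End MarginShattering.

Lemma margin_shattered_bound (R : realFieldType) (h d : nat) (x : 'I_h.+2 -> 'I_d -> R)
    (t : 'I_h.+2 -> R) (c rho2 : R) (m : nat) :
  0 <= c -> (0 < m < h.+2)%N -> (forall i, \sum_j x i j ^+ 2 <= rho2) -> margin_shattered x t c ->
  4 * c ^+ 2 * h.+1%:R * (m * (h.+2 - m))%:R < h.+2%:R ^+ 2 * rho2.
Proof.
move=> c0 /andP[m0 mh] xr sh.
pose n := (h.+2 - m)%N.
have n0 : (0 < n)%N by rewrite subn_gt0.
have nE : h.+2%:R = m%:R + n%:R :> R by rewrite -natrD subnKC // ltnW.
have mR : 0 < m%:R :> R by rewrite ltr0n.
have nR : 0 < n%:R :> R by rewrite ltr0n.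
pose a (i : 'I_h.+2) : R := if (i < m)%N then m%:R^-1 else - n%:R^-1.
have sum_a (u v : R) : \sum_(i < h.+2) (if (i < m)%N then u else v) = m%:R * u + n%:R * v.
  rewrite -(big_mkord predT (fun i => if (i < m)%N then u else v)).
  rewrite (big_cat_nat (leq0n m) (ltnW mh)); congr (_ + _).
    rewrite big_nat (eq_bigr (fun=> u)) => [|i /andP[_ ->]//].
    by rewrite -big_nat sumr_const_nat subn0 mulr_natl.
  rewrite big_nat (eq_bigr (fun=> v)) => [|i /andP[]]; last by rewrite leqNgt => /negbTE->.
  by rewrite -big_nat sumr_const_nat mulr_natl.
have a0 : \sum_i a i = 0 by rewrite sum_a mulrN !divff ?gt_eqF // subrr.
have [s] := exists_perm_small a0 xr.
have a2 : \sum_i a i ^+ 2 = m%:R^-1 + n%:R^-1.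
  rewrite (eq_bigr (fun i : 'I__ => if (i < m)%N then m%:R^-1 ^+ 2 else n%:R^-1 ^+ 2)) => [|i _].
    by rewrite sum_a; field; rewrite !gt_eqF.
  by rewrite /a; case: ifP => _; rewrite ?sqrrN.
rewrite a2 => le.
have := @margin_shattered_comb _ _ _ x t c (a \o s) c0 sh; rewrite /comp => lt.
have {}lt : 4 * c ^+ 2 < \sum_j (\sum_i a (s i) * x i j) ^+ 2.
  apply: lt => [||i].
  - by rewrite -[RHS]a0 [RHS](reindex_inj (@perm_inj _ s)).
  - have -> : 2 = \sum_i `|a i| :> R.
      rewrite (eq_bigr (fun i : 'I__ => if (i < m)%N then m%:R^-1 else n%:R^-1)) => [|i _].
        by rewrite sum_a !divff ?gt_eqF.
      by rewrite /a; case: ifP => _; rewrite ?normrN ger0_norm // invr_ge0.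
    by rewrite [RHS](reindex_inj (@perm_inj _ s)).
  - by rewrite /a; case: ifP => _; rewrite ?oppr_eq0 invr_eq0 gt_eqF.
have {lt le} lt : 4 * c ^+ 2 * h.+1%:R < (m%:R^-1 + n%:R^-1) * h.+2%:R * rho2.
  by apply: lt_le_trans le; rewrite mulrC ltr_pM2l ?ltr0n.
rewrite natrM -ltr_pdivlMr ?mulr_gt0 //; apply: lt_le_trans lt _.
by rewrite le_eqVlt; apply/orP; left; apply/eqP; rewrite nE; field; rewrite !gt_eqF.
Qed.
Lemma exists_net (T : finType) (b : nat) (G : {set {ffun T -> 'I_b.+2}}) :
  exists F : {set {ffun T -> _}}, [/\ F \subset G, separated F &
    forall g, g \in G -> exists2 f, f \in F & ~~ far f g].
Proof.
pose sep (F : {set {ffun T -> 'I_b.+2}}) := (F \subset G) &&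
  [forall f in F, forall g in F, (f != g) ==> far f g].
have sep0 : sep set0 by rewrite /sep sub0set; apply/forall_inP => f; rewrite inE.
have [F /maxsetP[/andP[FG /forall_inP sF] maxF] _] := maxset_exists sep0.
exists F; split => // [f g fF gF|g gG].
  exact/implyP/(forall_inP (sF f fF)).
apply/exists_inP; apply: contraT; rewrite negb_exists_in => /forall_inP farF.
have gF : g \notin F.
  apply/negP => /[dup] gF /farF; rewrite negbK => /existsP[i].
  by rewrite orbb addn2 ltnNge leqnSn.
have : g |: F = F.
  apply: maxF; last exact: subsetUr.
  rewrite /sep subUset sub1set gG FG /=; apply/forall_inP => f1 f1F.
  apply/forall_inP => f2 f2F; apply/implyP => f12.
  move: f1F f2F; rewrite !inE => /predU1P[e1|f1F] /predU1P[e2|f2F].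
  - by rewrite e1 e2 eqxx in f12.
  - rewrite e1; have := farF _ f2F; rewrite negbK => /existsP[i fi].
    by apply/existsP; exists i; rewrite orbC.
  - by rewrite e2; have := farF _ f1F; rewrite negbK.
  - exact: (implyP (forall_inP (sF _ f1F) _ f2F)).
by move/setP/(_ g); rewrite !inE eqxx (negbTE gF).
Qed.

Section Levels.
Variables (R : realFieldType) (c : R).

(* The six cells cut by the edges [-4c, -2c, 0, 2c, 4c]. The edge [4c] belongs to
   the cell below it and the other edges to the cell above, to agree with the
   strictness of the two margin conditions and of the sign test. *)
Definition level (v : R) : 'I_6 := inord
  ((- (4 * c) <= v)%R + (- (2 * c) <= v)%R + (0 <= v)%R + (2 * c <= v)%R + (4 * c < v)%R)%N.

Lemma levelE v : level v =
  ((- (4 * c) <= v)%R + (- (2 * c) <= v)%R + (0 <= v)%R + (2 * c <= v)%R + (4 * c < v)%R)%N :> nat.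
Proof. by rewrite inordK // ltnS -[5%N]/(1 + 1 + 1 + 1 + 1)%N !leq_add ?leq_b1. Qed.

Ltac case_level v :=
  case: (leP (- (4 * c)) v) => ?; case: (leP (- (2 * c)) v) => ?; case: (leP 0 v) => ?;
  case: (leP (2 * c) v) => ?; case: (ltP (4 * c) v) => ?.

Lemma level_gt v (l : 'I_5) : 0 <= c -> l != ord0 -> (l < level v)%N ->
  c * (2 * l%:R - 5) + c <= v.
Proof.
move=> c0 l0; rewrite levelE; case: l l0 => -[|[|[|[|[|l]]]]] //= _ _;
  case_level v => //= _; lra.
Qed.

Lemma level_lt v (l : 'I_5) : 0 <= c -> l != ord0 -> (level v < l)%N ->
  v < c * (2 * l%:R - 5) - c.
Proof.
move=> c0 l0; rewrite levelE; case: l l0 => -[|[|[|[|[|l]]]]] //= _ _;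
  case_level v => //= _; lra.
Qed.

Lemma level_sign v : 0 <= c -> (0 <= v) = (2 < level v)%N.
Proof.
move=> c0; rewrite levelE; case_level v => //=; lra.
Qed.

Lemma level_top v : 0 <= c -> (4 * c < v) = (4 < level v)%N.
Proof.
move=> c0; rewrite levelE; case_level v => //=; lra.
Qed.

Lemma level_bot v : 0 <= c -> (v < - (4 * c)) = (level v < 1)%N.
Proof.
move=> c0; rewrite levelE; case_level v => //=; lra.
Qed.

End Levels.

Lemma exists_margin_net (R : realFieldType) (T : finType) (d h m : nat)
    (x : T -> 'I_d -> R) (c rho2 : R) (G : {set {ffun T -> 'I_6}}) :
  (0 < #|T|)%N -> 0 <= c -> (0 < m < h.+2)%N ->
  (forall i, \sum_j x i j ^+ 2 <= rho2) ->
  h.+2%:R ^+ 2 * rho2 <= 4 * c ^+ 2 * h.+1%:R * (m * (h.+2 - m))%:R ->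
  (forall f, f \in G -> exists (w : 'I_d -> R) (b : R),
    \sum_j w j ^+ 2 <= 1 /\ forall i, f i = level c (\sum_j w j * x i j - b)) ->
  exists F : {set {ffun T -> _}}, [/\ F \subset G, forall g, g \in G -> exists2 f, f \in F & ~~ far f g &
    forall r, (#|small_patterns T 4 h.+1| < 2 ^ r)%N ->
      (#|F| < (#|T| * 6) ^ r)%N].
Proof.
move=> T0 c0 mh xr ch Gr; have [F [FG sF net]] := exists_net G.
exists F; split => // r small; rewrite ltnNge; apply/negP => big.
have sh := shattered_exp T0 sF big.
have /subsetPn[p] : ~~ (shattered F \subset small_patterns T 4 h.+1).
  apply/negP => /subset_leq_card le.
  by have := leq_trans sh le; rewrite leqNgt small.
rewrite !inE -ltnNge => /forallP shp hp.
pose e (i : 'I_h.+2) : T := enum_val (widen_ord hp i).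
have einj : injective e.
  by move=> i j /enum_val_inj /(congr1 val) ij; exact: val_inj.
have pe i : p (e i) != ord0 by have := enum_valP (widen_ord hp i); rewrite inE.
pose t i : R := c * (2 * (p (e i))%:R - 5).
suff : margin_shattered (x \o e) t c.
  move/(margin_shattered_bound c0 mh (fun i => xr (e i))).
  by rewrite ltNge ch.
move=> s; have /exists_inP[f fF /forallP fs] := shp [ffun y => [exists i, (e i == y) && s i]].
have [w [b [w1 fE]]] := Gr f (subsetP FG _ fF).
exists w, b; split => // i; have := fs (e i); rewrite pe ffunE /= => fei.
have -> : s i = [exists i0, (e i0 == e i) && s i0].
  apply/idP/existsP => [si|[j /andP[/eqP/einj -> //]]].
  by exists i; rewrite eqxx.
move: fei; case: ifP => _; rewrite fE.
- exact: level_gt.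
- exact: level_lt.
Qed.

From mathcomp Require Import all_classical all_reals all_analysis.
From mathcomp Require Import measurable_realfun.

Local Open Scope classical_set_scope.
Local Open Scope ring_scope.

Section OrbitCounting.
Variables (R : realType) (N k : nat).
Hypotheses (N0 : (0 < N)%N) (k0 : (0 < k)%N).

Definition deviation (lambda C m : R) : R :=
  k.+1%:R / k%:R * (1 - expR (- (lambda / N%:R)))^-1 *
  (1 - expR (- (lambda / N%:R ^+ 2) * m - C / N%:R)) - (k%:R * N%:R)^-1 * m.

Let NR : 0 < N%:R :> R. Proof. by rewrite ltr0n. Qed.
Let kR : 0 < k%:R :> R. Proof. by rewrite ltr0n. Qed.

Let expNu_lt1 (lambda : R) : 0 < lambda -> 0 < 1 - expR (- (lambda / N%:R)).
Proof. by move=> l0; rewrite subr_gt0 expR_lt1 oppr_lt0 divr_gt0. Qed.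

Lemma deviation_full lambda C : 0 < lambda -> 0 <= C -> 1 <= deviation lambda C N%:R.
Proof.
move=> l0 C0; have A0 := expNu_lt1 l0.
rewrite [X in X <= _](_ : 1 = k.+1%:R / k%:R * (1 - expR (- (lambda / N%:R)))^-1 *
    (1 - expR (- (lambda / N%:R))) - (k%:R * N%:R)^-1 * N%:R); last first.
  by rewrite -(natr1 k); field; rewrite !gt_eqF.
rewrite lerD2r; apply: ler_wpM2l; first by rewrite ?mulr_ge0 ?invr_ge0 ?ltW.
rewrite lerD2l lerN2 ler_expR.
have -> : lambda / N%:R ^+ 2 = lambda / N%:R / N%:R by field; rewrite gt_eqF.
by rewrite mulNr mulfVK ?gt_eqF // gerDl oppr_le0 divr_ge0 // ltW.
Qed.

(* As a function of [m] the deviation is concave and at least [1] at [m = N]. *)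
Lemma deviation_mono lambda C (m m' te : R) : 0 < lambda -> 0 <= C ->
  m <= m' <= N%:R -> te <= 1 -> te <= deviation lambda C m -> te <= deviation lambda C m'.
Proof.
move=> l0 C0 /andP[mm' mN] te1 tem; have A0 := expNu_lt1 l0.
pose P := k.+1%:R / k%:R * (1 - expR (- (lambda / N%:R)))^-1.
have P0 : 0 <= P by rewrite /P mulr_ge0 ?invr_ge0 ?ltW // divr_gt0 // ltr0n.
pose v := lambda / N%:R ^+ 2; pose e := expR (- v * m' - C / N%:R).
pose beta := P * (e * v) - (k%:R * N%:R)^-1.
have tangent x : deviation lambda C x <= deviation lambda C m' + beta * (x - m').
  rewrite /deviation -/P -/v -/e.
  have : e * (1 - v * (x - m')) <= expR (- v * x - C / N%:R).
    rewrite (_ : - v * x - C / N%:R = (- v * m' - C / N%:R) + - (v * (x - m'))); last by ring.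
    by rewrite expRD ler_wpM2l ?expR_ge0 // -/e; exact: expR_ge1Dx.
  rewrite -subr_ge0 => /(mulr_ge0 P0) le; rewrite -subr_ge0; apply: le_trans le _.
  by rewrite le_eqVlt; apply/orP; left; apply/eqP; rewrite /beta; ring.
have dN := deviation_full l0 C0.
have tm := tangent m; have tN := tangent N%:R.
by have [b0|b0] := leP 0 beta; nra.
Qed.

Variable sigma : 'I_N -> 'I_k.+1 -> bool.

Definition hits (a : {ffun 'I_N -> 'I_k.+1}) : nat := \sum_i sigma i (a i).
Definition total : nat := \sum_i \sum_c sigma i c.

Lemma total_le : (total <= k.+1 * N)%N.
Proof.
apply: (@leq_trans (\sum_(i < N) \sum_(c < k.+1) 1)).
  by apply: leq_sum => i _; apply: leq_sum => c _; case: sigma.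
by rewrite !sum_nat_const !card_ord muln1 mulnC.
Qed.

Lemma sum_exp_hits (u : R) : 0 < u ->
  \sum_a expR (- (u * (hits a)%:R)) <=
    k.+1%:R ^+ N * (1 - total%:R / (k.+1%:R * N%:R) * (1 - expR (- u))) ^+ N.
Proof.
move=> u0.
have -> : \sum_a expR (- (u * (hits a)%:R)) =
    \prod_(i < N) \sum_(c < k.+1) expR (- (u * (sigma i c)%:R)).
  rewrite bigA_distr_bigA; apply: eq_bigr => a _.
  by rewrite /hits natr_sum mulr_sumr -sumrN expR_sum.
have E0 i : 0 <= \sum_(c < k.+1) expR (- (u * (sigma i c)%:R)).
  by apply: sumr_ge0 => c _; exact: expR_ge0.
have := leif_AGM (A := predT) (fun i _ => E0 i).
rewrite card_ord -exprMn => -[le _].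
apply: le_trans le _; rewrite le_eqVlt; apply/orP; left; apply/eqP; congr (_ ^+ _).
have -> : \sum_(i in 'I_N) \sum_(c < k.+1) expR (- (u * (sigma i c)%:R)) =
    k.+1%:R * N%:R - total%:R * (1 - expR (- u)).
  have -> : k.+1%:R * N%:R = \sum_(i < N) \sum_(c < k.+1) 1 :> R.
    by rewrite !sumr_const !card_ord mulr_natr.
  rewrite /total natr_sum mulr_suml -sumrB; apply: eq_bigr => i _.
  rewrite natr_sum mulr_suml -sumrB; apply: eq_bigr => c _.
  by case: (sigma i c); rewrite ?mulr1n ?mulr0n ?mulr1 ?mulr0 ?oppr0 ?expR0; ring.
by field; rewrite !gt_eqF // ltr0n.
Qed.

Lemma miss_rate_gt0 (u : R) : 0 < u ->
  0 < 1 - total%:R / (k.+1%:R * N%:R) * (1 - expR (- u)).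
Proof.
move=> u0; have : total%:R / (k.+1%:R * N%:R) <= 1 :> R.
  by rewrite ler_pdivrMr ?mulr_gt0 ?ltr0n // mul1r -natrM ler_nat total_le.
have := expR_gt0 (- u); have : expR (- u) < 1 by rewrite expR_lt1 oppr_lt0.
by move: (expR _) (_ / _) => E p; nra.
Qed.

Definition exceeds C (a : {ffun 'I_N -> 'I_k.+1}) (lambda : R) :=
  deviation lambda C (hits a)%:R < (total%:R - (hits a)%:R) / (k%:R * N%:R).

Lemma exceeds_exp C a (lambda : R) (u := lambda / N%:R) : 0 < lambda -> exceeds C a lambda ->
  (1 - total%:R / (k.+1%:R * N%:R) * (1 - expR (- u))) ^+ N <
    expR (- (u * (hits a)%:R) - C).
Proof.
move=> l0; have A0 := expNu_lt1 l0; rewrite -/u in A0 => ex.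
have u0 : 0 < u by rewrite divr_gt0.
have q0 := miss_rate_gt0 u0.
have -> : - (u * (hits a)%:R) - C = N%:R * (- (u / N%:R * (hits a)%:R) - C / N%:R).
  by rewrite /u; field; rewrite gt_eqF.
rewrite expRM_natl ltrXn2r ?nnegrE ?expR_ge0 ?(ltW q0) -?lt0n //.
move: ex; rewrite /exceeds /deviation -/u.
have -> : lambda / N%:R ^+ 2 = u / N%:R by rewrite /u; field; rewrite gt_eqF.
rewrite mulNr; set e := expR (_ - _) => ex.
have {ex} : k.+1%:R / k%:R * (1 - expR (- u))^-1 * (1 - e) < total%:R / (k%:R * N%:R).
  move: ex; rewrite mulrBl ltrBlDr; congr (_ < _); ring.
have Kk0 : 0 < k.+1%:R / k%:R :> R by rewrite divr_gt0 // ltr0n.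
rewrite -mulrA -ltr_pdivlMl // mulrC ltr_pdivrMr //.
have -> : (k.+1%:R / k%:R)^-1 * (total%:R / (k%:R * N%:R)) = total%:R / (k.+1%:R * N%:R) :> R.
  by field; rewrite !gt_eqF // ltr0n.
by rewrite !ltrBlDr addrC.
Qed.

(* One [lambda] suffices: a violator with the most hits is violated at some
   [lambda], and the exponential moment at that [lambda] controls all the others. *)
Lemma card_exceeds C (V : {set {ffun 'I_N -> 'I_k.+1}}) :
  (forall a, a \in V -> exists2 lambda, 0 < lambda & exceeds C a lambda) ->
  #|V|%:R <= k.+1%:R ^+ N * expR (- C).
Proof.
move=> Vex; have [->|[a0 a0V]] := set_0Vmem V.
  by rewrite cards0 mulr_ge0 ?expR_ge0 ?exprn_ge0.
case: (arg_maxnP hits a0V) => a aV amax.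
have [lambda l0 ex] := Vex a aV.
pose u := lambda / N%:R; have u0 : 0 < u by rewrite divr_gt0.
have lt := exceeds_exp l0 ex; rewrite -/u in lt.
have le := sum_exp_hits u0.
set q := 1 - _ in lt le.
have q0 : 0 < q ^+ N by rewrite exprn_gt0 // miss_rate_gt0.
have : #|V|%:R * (q ^+ N * expR C) <= k.+1%:R ^+ N * q ^+ N.
  apply: le_trans le.
  apply: (@le_trans _ _ (\sum_(a1 in V) expR (- (u * (hits a1)%:R)))).
    rewrite mulr_natl -sumr_const; apply: ler_sum => a1 a1V.
    apply: (@le_trans _ _ (expR (- (u * (hits a)%:R)))).
      rewrite -ler_pdivlMr ?expR_gt0 // -expRN -expRD; exact: ltW.
    rewrite ler_expR lerN2; apply: ler_wpM2l; first exact: ltW.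
    by rewrite ler_nat; exact: amax.
  rewrite big_mkcond; apply: ler_sum => a1 _; case: ifP => // _; exact: expR_ge0.
by rewrite expRN ler_pdivlMr ?expR_gt0 // mulrA mulrAC ler_pM2r.
Qed.

End OrbitCounting.

Section Orbits.
Variables (R : realType) (N k d : nat).
Local Notation Om := (Omega R N k d).
Implicit Types (a b : {ffun 'I_N -> 'I_k.+1}) (l : 'I_(k.+1 * N)).

Lemma cell_subproof (c : 'I_k.+1) (i : 'I_N) : (c * N + i < k.+1 * N)%N.
Proof.
by rewrite (@leq_trans (c * N + N)%N) ?ltn_add2l // addnC -mulSn leq_pmul2r ?(leq_trans _ (ltn_ord i)).
Qed.

Definition cell c i : 'I_(k.+1 * N) := Ordinal (cell_subproof c i).

Lemma sample_gt0 l : (0 < N)%N.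
Proof. by case: N l => // -[l]; rewrite muln0. Qed.

Lemma blk_subproof l : (l %/ N < k.+1)%N.
Proof. by rewrite ltn_divLR ?(sample_gt0 l). Qed.

Definition blk l : 'I_k.+1 := Ordinal (blk_subproof l).

Lemma row_subproof l : (l %% N < N)%N.
Proof. by rewrite ltn_mod (sample_gt0 l). Qed.

Definition rowi l : 'I_N := Ordinal (row_subproof l).

Lemma cellK l : cell (blk l) (rowi l) = l.
Proof. by apply/val_inj; rewrite /= -divn_eq. Qed.

Lemma blkK c i : blk (cell c i) = c.
Proof.
have N0 : (0 < N)%N by apply: leq_trans (ltn_ord i).
by apply/val_inj; rewrite /= divnMDl // divn_small ?addn0.
Qed.

Lemma rowK c i : rowi (cell c i) = i.
Proof. by apply/val_inj; rewrite /= modnMDl modn_small. Qed.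

Definition shift a l := cell (blk l + a (rowi l)) (rowi l).

Lemma shift_cell a c i : shift a (cell c i) = cell (c + a i) i.
Proof. by rewrite /shift blkK rowK. Qed.

Lemma shiftD a b l : shift a (shift b l) = shift (a + b) l.
Proof. by rewrite -[l]cellK !shift_cell ffunE -addrA [b _ + _]addrC. Qed.

Lemma shift0 l : shift 0 l = l.
Proof. by rewrite -[l]cellK shift_cell ffunE addr0. Qed.

Lemma shift_bij a : bijective (shift a).
Proof. by exists (shift (- a)) => l; rewrite shiftD ?addNr ?addrN shift0. Qed.

Definition act a (omega : Om) : Om :=
  [tuple tnth omega (shift a l) | l < k.+1 * N].

Lemma actD a b omega : act a (act b omega) = act (a + b) omega.
Proof.
by apply/eq_from_tnth => l; rewrite !tnth_mktuple shiftD [b + a]addrC.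
Qed.

Lemma act0 omega : act 0 omega = omega.
Proof. by apply/eq_from_tnth => l; rewrite tnth_mktuple shift0. Qed.

Definition back (i : 'I_N) : {ffun 'I_N -> 'I_k.+1} :=
  [ffun j => if j == i then inZp k else 0].

Lemma tau_act (i : 'I_N) omega : tau i omega = act (back i) omega.
Proof.
apply/eq_from_tnth => l; rewrite !tnth_mktuple; congr tnth.
rewrite -{2}[l]cellK shift_cell /tau_index ffunE.
have -> : (l %% N == i)%N = (rowi l == i) by [].
case: (rowi l =P i) => [li|_]; last by rewrite addr0 cellK.
suff e : (if (l < N)%N then l + k * N else l - N)%N = cell (blk l + inZp k) (rowi l) :> nat.
  by apply/val_inj; rewrite val_insubd e ltn_ord.
have N0 := sample_gt0 l.
rewrite ltnNge -divn_gt0 //= [(k %% k.+1)%N]modn_small //.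
move: (divn_eq l N) (blk_subproof l); case: (l %/ N)%N => [|c] lE cK /=.
  by rewrite add0n modn_small // {1}lE mul0n addnC.
by rewrite addSn -addnS modnDr modn_small 1?ltnW // {1}lE mulSn -addnA addKn.
Qed.

Lemma measurable_act a : measurable_fun setT (act a).
Proof.
apply/measurable_fun_tnthP => l.
rewrite (_ : _ \o _ = (@tnth _ _)^~ (shift a l)); first exact: measurable_tnth.
by apply/funext => omega /=; rewrite tnth_mktuple.
Qed.

Lemma sum_cells (V : nmodType) (F : 'I_(k.+1 * N) -> V) :
  \sum_l F l = \sum_i \sum_c F (cell c i).
Proof.
rewrite pair_big /= (reindex (fun p : 'I_N * 'I_k.+1 => cell p.2 p.1)) //.
exists (fun l => (rowi l, blk l)) => [[i c]|l] _ /=; last exact: cellK.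
by rewrite rowK blkK.
Qed.

Lemma sum_train (V : nmodType) (F : 'I_(k.+1 * N) -> V) :
  \sum_(l < k.+1 * N | (l < N)%N) F l = \sum_i F (cell 0 i).
Proof.
rewrite big_mkcond sum_cells; apply: eq_bigr => i _.
rewrite (bigD1 0) //= mul0n add0n ltn_ord big1 ?addr0 // => c c0.
rewrite ltnNge (leq_trans _ (leq_addr _ _)) // leq_pmull // lt0n.
by apply: contra c0 => /eqP c0; apply/eqP/val_inj.
Qed.

Variables (P : probability Om R) (exch : partially_exchangeable P).

Lemma act_invariant a A : measurable A -> P (act a @^-1` A) = P A.
Proof.
pose inv a := forall A, measurable A -> P (act a @^-1` A) = P A.
have mact b B : measurable B -> measurable (act b @^-1` B).
  by move=> mB; rewrite -[X in measurable X]setTI; exact: measurable_act.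
have inv0 : inv 0 by move=> B _; congr (P _); apply/seteqP; split=> w /=; rewrite act0.
have invD b c : inv b -> inv c -> inv (b + c).
  move=> ib ic B mB; rewrite -(ib _ mB) -(ic _ (mact b B mB)); congr (P _).
  by apply/seteqP; split=> w /=; rewrite actD.
have invback i : inv (back i).
  move=> B mB; rewrite -(exch i mB); congr (P _).
  by apply/seteqP; split=> w /=; rewrite tau_act.
suff : inv a by exact.
have -> : a = \sum_i back i *+ (k * a i).
  apply/ffunP => j; rewrite sum_ffunE (bigD1 j) //= big1 => [|i ij].
    rewrite addr0 ffunMnE ffunE eqxx Zp_mulrn; apply/val_inj => /=.
    rewrite modnMml mulnA; case: k (a j) => [|k'] [x xk] /=.
      by move: xk; rewrite ltnS leqn0 => /eqP ->.
    rewrite (_ : k'.+1 * k'.+1 * x = (k' * x) * k'.+2 + x)%N ?modnMDl ?modn_small //.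
    ring.
  by rewrite ffunMnE ffunE eq_sym (negbTE ij) mul0rn.
apply: (big_ind inv) => // i _; elim: (k * a i)%N => [|m IH]; first by rewrite mulr0n.
by rewrite mulrS; apply: invD.
Qed.

Lemma orbit_measure (B : set Om) (beta : R) : measurable B -> 0 <= beta ->
  (forall omega, #|[set a | `[< B (act a omega) >]]%SET|%:R <= beta * k.+1%:R ^+ N) ->
  (P B <= beta%:E)%E.
Proof.
move=> mB beta0 count.
have mact b : measurable (act b @^-1` B).
  by rewrite -[X in measurable X]setTI; exact: measurable_act.
have [p pE] : exists p, P B = p%:E.
  by exists (fine (P B)); rewrite fineK // fin_num_measure.
pose K := #|{ffun 'I_N -> 'I_k.+1}|.
have KE : K%:R = k.+1%:R ^+ N :> R by rewrite /K card_ffun !card_ord natrX.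
have K0 : 0 < k.+1%:R ^+ N :> R by rewrite exprn_gt0 ?ltr0n.
have E : (\int[P]_omega \sum_(a : {ffun 'I_N -> 'I_k.+1}) (\1_(act a @^-1` B) omega)%:E
    = (p *+ K)%:E)%E.
  rewrite ge0_integral_sum //=; last first.
    by move=> b; apply/measurable_EFinP; exact: measurable_indic.
  rewrite (eq_bigr (fun=> p%:E)) => [|b _]; first by rewrite sumEFin sumr_const.
  by rewrite integral_indic // setIT -pE; exact: act_invariant.
have : (\int[P]_omega \sum_(a : {ffun 'I_N -> 'I_k.+1}) (\1_(act a @^-1` B) omega)%:E
    <= \int[P]_omega (cst (beta * k.+1%:R ^+ N)%:E omega))%E.
  apply: ge0_le_integral => //.
  - by move=> omega _; apply: sume_ge0 => b _; rewrite lee_fin.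
  - by apply: emeasurable_sum => b; apply/measurable_EFinP; exact: measurable_indic.
  - move=> omega _ /=; rewrite sumEFin lee_fin; apply: le_trans (count omega).
    rewrite -sum1_card natr_sum [leRHS]big_mkcond /=; apply: ler_sum => b _.
    rewrite finset.in_set indicE; case: asboolP => Bb; first by rewrite mem_set.
    by rewrite memNset.
rewrite E integral_cst // [X in (_ * X)%E](_ : _ = 1%E); last exact: probability_setT.
by rewrite mule1 pE !lee_fin -[p *+ K]mulr_natr KE ler_pM2r.
Qed.

End Orbits.

Lemma entropy_bound (R : realType) (T : finType) (h s : nat) (n : R := #|T|%:R) :
  (0 < #|T|)%N -> (h.+2 <= 4 * #|T|)%N ->
  (forall r, (#|small_patterns T 4 h.+1| < 2 ^ r)%N -> (s < (#|T| * 6) ^ r)%N) ->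
  s%:R <= expR (ln (20 * n) *
    (h.+2%:R / ln 2 * ln (4 * expR 1 * n / h.+2%:R) + 1)) :> R.
Proof.
move=> T0 hT bound.
have n0 : 0 < n by rewrite ltr0n.
have n1 : 1 <= n by rewrite ler1n.
have h0 : 0 < h.+2%:R :> R by rewrite ltr0n.
have ln20 : 0 < ln 2 :> R by rewrite ln_gt0 // ltr1n.
have hn : h.+2%:R <= 4 * n by rewrite -natrM ler_nat.
have e1 : 1 <= expR 1 :> R by rewrite -[leLHS]expR0 ler_expR.
have z1 : 1 <= 4 * expR 1 * n / h.+2%:R by rewrite ler_pdivlMr // mul1r; nra.
set z := (4 * expR 1 * n / h.+2%:R) in z1 *.
set y := h.+2%:R / ln 2 * ln z.
have y0 : 0 <= y by rewrite mulr_ge0 ?ln_ge0 // divr_ge0 // ltW.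
have /andP[yl yu] := truncn_itv y0.
set r := (Num.truncn y).+1 in yu.
have small : (#|small_patterns T 4 h.+1| < 2 ^ r)%N.
  rewrite -(ltr_nat R) natrX.
  pose x : R := h.+2%:R / (4 * n).
  have x0 : 0 < x by rewrite divr_gt0 // mulr_gt0.
  have x1 : x <= 1 by rewrite ler_pdivrMr ?mulr_gt0 // mul1r.
  have := card_small_patterns T 4 h.+2 x0 x1.
  have : (1 + 4 * x) ^+ #|T| <= expR h.+2%:R.
    have -> : h.+2%:R = #|T|%:R * (4 * x) by rewrite -/n /x; field; rewrite gt_eqF.
    rewrite expRM_natl; apply: lerXn2r; rewrite ?nnegrE ?expR_ge0 ?expR_ge1Dx //.
    by rewrite addr_ge0 // mulr_ge0 // ltW.
  move=> le1 le2; have := le_trans le2 le1.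
  rewrite -ler_pdivlMr ?exprn_gt0 // => {le1 le2} le.
  have : #|small_patterns T 4 h.+1|%:R <= expR h.+2%:R / x ^+ h.+2.
    apply: le_trans le; rewrite ler_nat; exact/subset_leq_card/small_patternsS.
  move/le_lt_trans; apply.
  have -> : expR h.+2%:R / x ^+ h.+2 = z ^+ h.+2.
    rewrite -[h.+2%:R]mulr1 expRM_natl -expr_div_n; congr (_ ^+ _).
    by rewrite /x /z; field; rewrite !gt_eqF.
  rewrite -(@lnK _ z) ?posrE ?(lt_le_trans ltr01) // -(@lnK _ 2) ?posrE //.
  rewrite -!expRM_natl ltr_expR -ltr_pdivrMr //.
  by rewrite mulrAC.
have s_lt := bound r small.
apply: (@le_trans _ _ ((20 * n) ^+ r)).
  apply: (@le_trans _ _ ((#|T| * 6) ^ r)%:R); first by rewrite ler_nat ltnW.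
  by rewrite natrX; apply: lerXn2r; rewrite ?nnegrE ?mulr_ge0 ?(ltW n0) // natrM -/n; nra.
have n20 : 1 <= 20 * n by nra.
rewrite -[X in X ^+ r](@lnK _ (20 * n)) ?posrE ?(lt_le_trans ltr01) //.
rewrite -expRM_natl ler_expR mulrC; apply: ler_wpM2l; first exact: ln_ge0.
by rewrite /r -natr1 lerD2r.
Qed.

Section Complexity.
Variables (R : realType) (N k : nat) (eps : R) (h : nat).
Hypotheses (N0 : (0 < N)%N) (eps0 : 0 < eps) (eps1 : eps < 1).
Hypothesis hb : (1 <= h <= 4 * (k.+1 * N))%N.

Lemma complexity_ge0 : 0 <= complexity N k eps h.
Proof.
have /andP[h1 h4] := hb.
have n1 : 1 <= k.+1%:R * N%:R :> R by rewrite -natrM ler1n muln_gt0 N0.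
have hR : 0 < h%:R :> R by rewrite ltr0n.
have h1R : 1 <= h%:R :> R by rewrite ler1n.
have hn : h%:R <= 4 * (k.+1%:R * N%:R) :> R by rewrite -!natrM ler_nat.
have e1 : 1 <= expR 1 :> R by rewrite -[leLHS]expR0 ler_expR.
rewrite /complexity; apply: addr_ge0.
  apply: mulr_ge0; first by apply: ln_ge0; nra.
  apply: addr_ge0 => //; apply: mulr_ge0; first by rewrite divr_ge0 // ln_ge0 // ler1n.
  by apply: ln_ge0; rewrite ler_pdivlMr // mul1r; nra.
apply: ln_ge0; rewrite ler_pdivlMr // mul1r.
have /(mulr_ege1 h1R) hh : 1 <= h.+1%:R :> R by rewrite ler1n.
by rewrite -mulrA; apply: le_trans (ltW eps1) _; lra.
Qed.

Lemma expR_complexity (n : R := k.+1%:R * N%:R) :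
  expR (ln (20 * n) * (h%:R / ln 2 * ln (4 * expR 1 * n / h%:R) + 1)) *
    expR (- complexity N k eps h) = eps / (2 * h%:R * h.+1%:R).
Proof.
have /andP[h1 _] := hb.
have q0 : 0 < 2 * h%:R * h.+1%:R / eps :> R by rewrite divr_gt0 // !mulr_gt0 ?ltr0n.
rewrite -expRD /complexity -/n opprD addrA subrr add0r expRN lnK ?posrE //.
by rewrite invf_div.
Qed.

End Complexity.

Section Violations.
Variables (R : realType) (N k d : nat).
Local Notation Om := (Omega R N k d).
Implicit Types (omega : Om) (w : d.-tuple R) (a : {ffun 'I_N -> 'I_k.+1}).
Hypotheses (N0 : (0 < N)%N) (k0 : (0 < k)%N).

Lemma enorm_sqr (x : d.-tuple R) : enorm x ^+ 2 = \sum_(j < d) tnth x j ^+ 2.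
Proof. by rewrite sqr_sqrtr // sumr_ge0 // => j _; exact: sqr_ge0. Qed.

Lemma radius_ge0 omega : 0 <= Defs.radius omega.
Proof. exact: bigmax_ge_id. Qed.

Lemma enorm_le_radius omega l : enorm (X omega l) <= Defs.radius omega.
Proof. exact: (le_bigmax 0 (fun l => enorm (X omega l))). Qed.

Lemma X_act a omega l : X (act a omega) l = X omega (shift a l).
Proof. by rewrite /X tnth_mktuple. Qed.

Lemma Y_act a omega l : Y (act a omega) l = Y omega (shift a l).
Proof. by rewrite /Y tnth_mktuple. Qed.

Lemma radius_act a omega : Defs.radius (act a omega) = Defs.radius omega.
Proof.
have le (b : {ffun _}) (om : Om) : Defs.radius (act b om) <= Defs.radius om.
  apply/bigmax_leP; split=> [|l _]; first exact: radius_ge0.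
  by rewrite X_act enorm_le_radius.
by apply/eqP; rewrite eq_le le /= -{1}[omega]act0 -(addNr a) -actD le.
Qed.

Lemma margin_act a omega h : margin (act a omega) h = margin omega h.
Proof. by rewrite /margin radius_act. Qed.

(* [gamma h] is the bound given by [margin_shattered_bound] with [m = h./2] for
   [h] points of a ball of radius 1. *)
Lemma margin_finite omega h : exists c : R, [/\ 0 <= c,
  margin omega h.+2 = (4 * c)%:E &
  h.+2%:R ^+ 2 * Defs.radius omega ^+ 2 <=
    4 * c ^+ 2 * h.+1%:R * ((h.+2)./2 * (h.+2 - (h.+2)./2))%:R].
Proof.
set rho := Defs.radius omega; have rho0 : 0 <= rho := radius_ge0 omega.
have h1 : 0 < h.+1%:R :> R by rewrite ltr0n.
have h2 : 0 < h.+2%:R :> R by rewrite ltr0n.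
pose m := (h.+2)./2; pose p : R := (m * (h.+2 - m))%:R.
pose q : R := 4 * h.+1%:R * p / h.+2%:R ^+ 2.
have mh : (m <= h.+2)%N by rewrite /m -divn2 leq_div.
have p0 : 0 < p by rewrite ltr0n muln_gt0 subn_gt0 /m -divn2 ltn_Pdiv // divn_gt0.
have q0 : 0 < q by rewrite divr_gt0 ?exprn_gt0 // !mulr_gt0.
have gE : gamma R h.+2 = ((Num.sqrt q)^-1)%:E.
  rewrite /gamma /=; have := odd_double_half h.+2; rewrite -/m /= negbK => hE.
  have hR : h.+2%:R = (odd h)%:R + 2 * m%:R :> R.
    by rewrite -natrM -natrD mul2n hE.
  rewrite [in RHS]/q /p natrM natrB //.
  have m0 : 0 < m%:R :> R by rewrite ltr0n.
  have -> : h.+1%:R = h.+2%:R - 1 :> R by rewrite -[h.+2%:R]natr1 addrK.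
  case: (odd h) hE hR => hE hR; congr ((Num.sqrt _)^-1)%:E.
    have -> : m%:R = (h.+2%:R - 1) / 2 :> R by rewrite hR mulr1n; field.
    by move: (h.+2%:R) h2 => y y0; field; rewrite gt_eqF.
  have -> : m%:R = h.+2%:R / 2 :> R by rewrite hR mulr0n; field.
  by move: (h.+2%:R) h2 => y y0; field; rewrite gt_eqF.
exists (rho * (Num.sqrt q)^-1); split.
- by rewrite mulr_ge0 // invr_ge0 sqrtr_ge0.
- by rewrite /margin gE mulrA.
- rewrite exprMn exprVn sqr_sqrtr ?(ltW q0) // -/m -/p le_eqVlt; apply/orP; left; apply/eqP.
  rewrite /q; move: (p) p0 (h.+1%:R) h1 (h.+2%:R) h2 => p' p'0 y y0 z z0.
  by field; rewrite !gt_eqF.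
Qed.

Lemma sum_test (F : 'I_(k.+1 * N) -> nat) :
  \sum_(l < k.+1 * N | (N <= l)%N) F l = (\sum_l F l - \sum_(l < k.+1 * N | (l < N)%N) F l)%N.
Proof.
rewrite [X in (X - _)%N](bigID (fun l : 'I__ => (l < N)%N)) /= addKn.
by apply: eq_bigl => l; rewrite -leqNgt.
Qed.

Lemma test_error_le1 w b omega : test_error w b omega <= 1.
Proof.
have kN : 0 < k%:R * N%:R :> R by rewrite mulr_gt0 ?ltr0n.
rewrite /test_error mulrC ler_pdivrMr // mul1r.
apply: (@le_trans _ _ (\sum_(l < k.+1 * N | (N <= l)%N) 1)%:R).
  by rewrite natr_sum; apply: ler_sum => l _; rewrite ler_nat leq_b1.
rewrite sum_test sum_train (eq_bigr (fun=> 1%N)) // !sum1_card !card_ord.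
by rewrite mulSn addKn natrM.
Qed.

Lemma margin_errors_le w b h omega : margin_errors w b h omega <= N%:R.
Proof.
rewrite /margin_errors sum_train -[N in leRHS]card_ord -sum1_card natr_sum.
by apply: ler_sum => i _; rewrite ler_nat leq_b1.
Qed.

Variables (eps : R) (eps0 : 0 < eps) (eps1 : eps < 1).

Definition violated h w b omega := exists2 lambda : R, 0 < lambda &
  margin_bound eps w b lambda h omega < test_error w b omega.

(* The cells at distance at most one from those of misclassified points: they
   still lie inside the margin. *)
Definition cell_error (y : bool) (v : 'I_6) := if y then (v <= 3)%N else (2 <= v)%N.

Lemma card_violated h omega : (h.+2 <= 4 * (k.+1 * N))%N ->
  #|[set a | `[< exists w b, enorm w <= 1 /\ violated h.+2 w b (act a omega) >]]%SET|%:R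
    <= eps / (2 * h.+2%:R * h.+3%:R) * k.+1%:R ^+ N.
Proof.
move=> hn; have [c [c0 mE mc]] := margin_finite omega h.
have hb : (1 <= h.+2 <= 4 * (k.+1 * N))%N by [].
pose T := 'I_(k.+1 * N); have TE : #|T| = (k.+1 * N)%N by rewrite card_ord.
have T0 : (0 < #|T|)%N by rewrite TE muln_gt0 N0.
pose x (l : T) (j : 'I_d) := tnth (X omega l) j.
pose G := [set f : {ffun T -> 'I_6} | `[< exists (w : 'I_d -> R) (b : R),
  \sum_j w j ^+ 2 <= 1 /\ forall l, f l = level c (\sum_j w j * x l j - b) >]]%SET.
have mh : (0 < (h.+2)./2 < h.+2)%N by rewrite -divn2 ltn_Pdiv // divn_gt0.
have xr l : \sum_j x l j ^+ 2 <= Defs.radius omega ^+ 2.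
  by rewrite -enorm_sqr lerXn2r ?nnegrE ?sqrtr_ge0 ?radius_ge0 ?enorm_le_radius.
have [|F [_ net Fcard]] := @exists_margin_net R T d h _ x c _ G T0 c0 mh xr mc.
  by move=> f; rewrite finset.in_set => /asboolP.
have hT : (h.+2 <= 4 * #|T|)%N by rewrite TE.
have := entropy_bound R T0 hT Fcard; rewrite TE natrM.
set C := complexity N k eps h.+2 => Fle.
pose sigma (f : {ffun T -> 'I_6}) i b := cell_error (tnth omega (cell b i)).2 (f (cell b i)).
pose V f := [set a | `[< exists2 lambda : R, 0 < lambda & exceeds (sigma f) C a lambda >]]%SET.
apply: (@le_trans _ _ (\sum_(f in F) #|V f|%:R)); last first.
  apply: (@le_trans _ _ (\sum_(f in F) k.+1%:R ^+ N * expR (- C))).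
    apply: ler_sum => f _; apply: (card_exceeds N0 k0 (sigma := sigma f)) => a.
    by rewrite finset.in_set => /asboolP.
  rewrite sumr_const -[_ *+ #|_|]mulr_natl mulrA mulrAC.
  apply: ler_wpM2r; first by rewrite exprn_ge0.
  rewrite -(expR_complexity eps0 hb); apply: ler_wpM2r => //; exact: expR_ge0.
rewrite -natr_sum ler_nat; apply: (@leq_trans #|\bigcup_(f in F) V f|%SET); last first.
  elim/big_rec2: _ => [|f s A _ IH]; first by rewrite cards0.
  by rewrite (leq_trans (leq_card_setU _ _)) // leq_add2l.
apply/subset_leq_card/fintype.subsetP => a; rewrite finset.in_set => /asboolP.
move=> [w [b [w1 [lambda l0 viol]]]].
pose v l := \sum_j tnth w j * x l j - b.
pose f0 : {ffun T -> 'I_6} := [ffun l => level c (v l)].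
have f0G : f0 \in G.
  rewrite finset.in_set; apply/asboolP; exists (tnth w), b; split.
    by rewrite -enorm_sqr expr_le1 // sqrtr_ge0.
  by move=> l; rewrite ffunE.
have [f fF near] := net _ f0G; apply/finset.bigcupP; exists f => //.
rewrite finset.in_set; apply/asboolP; exists lambda => //.
rewrite /exceeds ltNge; apply/negP => le.
move: viol; rewrite ltNge => /negP[].
pose s l : bool := cell_error (tnth omega (shift a l)).2 (f (shift a l)).
have nearE l : (f0 l <= (f l).+1)%N && (f l <= (f0 l).+1)%N.
  move: near; rewrite /far negb_exists => /forallP/(_ l).
  by rewrite negb_or !addn2 -!ltnNge !ltnS andbC.
have gE l : g w b (X (act a omega) l) = v (shift a l) by rewrite X_act.
have levE l : f0 l = level c (v l) by rewrite ffunE.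
have hitsE : (hits (sigma f) a = \sum_(l < k.+1 * N | (l < N)%N) s l)%N.
  rewrite sum_train; apply: eq_bigr => i _.
  by rewrite /s /sigma shift_cell add0r.
have totalE : (total (sigma f) = \sum_l s l)%N.
  rewrite (reindex (shift (- a))) /=; last exact/onW_bij/shift_bij.
  rewrite sum_cells; apply: eq_bigr => i _; apply: eq_bigr => b' _.
  by rewrite /s shiftD subrr shift0.
have te : test_error w b (act a omega) <=
    ((total (sigma f))%:R - (hits (sigma f) a)%:R) / (k%:R * N%:R).
  have hle : (hits (sigma f) a <= total (sigma f))%N.
    by rewrite hitsE totalE [leqRHS](bigID (fun l : 'I__ => (l < N)%N)) leq_addr.
  rewrite -natrB // totalE hitsE -sum_test /test_error mulrC ler_pM2r ?invr_gt0 ?mulr_gt0 ?ltr0n //.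
  rewrite natr_sum; apply: ler_sum => l _; rewrite ler_nat gE Y_act /Y /s.
  have := nearE (shift a l); rewrite levE; have := level_sign (v (shift a l)) c0.
  case: (tnth _ _).2 => /= ->; case: leqP => /= lt.
  - move=> /andP[_ le1]; apply: (leq_trans (leq_b1 _)); rewrite lt0b.
    exact: leq_trans le1 _.
  - by move=> _; rewrite mulr1 (_ : 2 - 1 = 1 :> R) ?eqxx //; ring.
  - by rewrite mulr0 sub0r eqxx.
  - move=> /andP[le1 _]; apply: (leq_trans (leq_b1 _)); rewrite lt0b.
    by rewrite -ltnS; exact: leq_trans lt le1.
have me : (hits (sigma f) a)%:R <= margin_errors w b h.+2 (act a omega).
  rewrite hitsE natr_sum /margin_errors; apply: ler_sum => l _.
  rewrite margin_act mE lee_fin gE Y_act /Y /s.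
  have := nearE (shift a l); rewrite levE.
  have := level_top (v (shift a l)) c0; have := level_bot (v (shift a l)) c0.
  case: (tnth _ _).2 => /= bot top /andP[le1 le2].
    rewrite ler_nat; case: (leqP (f (shift a l)) 3) => // le3; rewrite mulr1 leNgt top.
    by rewrite -leqNgt (leq_trans le1).
  rewrite ler_nat; case: (leqP 2 (f (shift a l))) => // le3; rewrite mulrN1 lerNl leNgt bot.
  rewrite (_ : (level _ _ < 1)%N = false) //; apply/negbTE; rewrite -leqNgt.
  exact: leq_trans le3 le2.
rewrite -[leRHS]/(deviation N k lambda C (margin_errors w b h.+2 (act a omega))).
apply: (deviation_mono N0 k0 l0 _ _ (test_error_le1 _ _ _) (le_trans te le)).
- exact: complexity_ge0.
- by rewrite me margin_errors_le.
Qed.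

End Violations.

Lemma measurable_finite_test (d : measure_display) (T : measurableType d) (I : finType)
    (e : I -> T -> bool) (Q : {ffun I -> bool} -> Prop) :
  (forall i, measurable_fun setT (e i)) ->
  measurable [set t | Q [ffun i => e i t]].
Proof.
move=> me.
have -> : [set t | Q [ffun i => e i t]] =
    \bigcup_(v in Q) \bigcap_(i in setT) (e i @^-1` [set v i]).
  apply/seteqP; split=> t /= => [Qt|[v Qv vt]].
    by exists [ffun i => e i t] => // i _ /=; rewrite ffunE.
  rewrite (_ : [ffun i => e i t] = v) //; apply/ffunP => i; rewrite ffunE; exact: vt.
apply: fin_bigcup_measurable => [|v _]; first exact: finite_finset.
apply: fin_bigcap_measurable => [|i _]; first exact: finite_finset.
by rewrite -[X in measurable X]setTI; apply: me.
Qed.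

Section Measurability.
Variables (R : realType) (N k d : nat).
Local Notation Om := (Omega R N k d).

Lemma measurable_coord l j :
  measurable_fun setT (fun omega : Om => tnth (X omega l) j : measurableTypeR R).
Proof.
apply: (measurableT_comp (measurable_tnth j)).
exact: (measurableT_comp measurable_fst (measurable_tnth l)).
Qed.

Lemma measurable_label l : measurable_fun setT (fun omega : Om => (tnth omega l).2).
Proof. exact: (measurableT_comp measurable_snd (measurable_tnth l)). Qed.

Lemma measurable_Y l : measurable_fun setT (fun omega : Om => Y omega l).
Proof. by apply: measurable_fun_ifT => //; exact: measurable_label. Qed.

Lemma measurable_g w b l : measurable_fun setT (fun omega : Om => g w b (X omega l)).
Proof.
apply: measurable_funB => //; apply: measurable_sum => j.
by apply: measurable_funM => //; exact: measurable_coord.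
Qed.

Lemma measurable_radius : measurable_fun setT (fun omega : Om => Defs.radius omega).
Proof.
rewrite /Defs.radius; elim: (index_enum _) => [|l s IH].
  by under eq_fun do rewrite big_nil; exact: measurable_cst.
under eq_fun do rewrite big_cons; apply: measurable_maxr => //.
apply: (measurableT_comp (continuous_measurable_fun (@sqrt_continuous R))).
by apply: measurable_sum => j; apply: measurable_funX; exact: measurable_coord.
Qed.

Lemma measurable_violated eps h w b :
  measurable [set omega : Om | violated eps h.+2 w b omega].
Proof.
pose e (p : 'I_(k.+1 * N) * bool) (omega : Om) : bool :=
  if p.2 then ((g w b (X omega p.1) * Y omega p.1)%:E <= margin omega h.+2)%E
  else 2 * (0 <= g w b (X omega p.1))%R%:R - 1 != Y omega p.1.
pose Q (f : {ffun 'I_(k.+1 * N) * bool -> bool}) := exists2 lambda : R, 0 < lambda &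
  deviation N k lambda (complexity N k eps h.+2)
    (\sum_(l < k.+1 * N | (l < N)%N) (f (l, true))%:R) <
  (k%:R * N%:R)^-1 * \sum_(l < k.+1 * N | (N <= l)%N) (f (l, false))%:R.
have meE omega : margin_errors w b h.+2 omega =
    \sum_(l < k.+1 * N | (l < N)%N) ([ffun p => e p omega] (l, true))%:R.
  by apply: eq_bigr => l _; rewrite ffunE.
have teE omega : test_error w b omega = (k%:R * N%:R)^-1 *
    \sum_(l < k.+1 * N | (N <= l)%N) ([ffun p => e p omega] (l, false))%:R.
  by congr (_ * _); apply: eq_bigr => l _; rewrite ffunE.
rewrite (_ : [set _ | _] = [set omega | Q [ffun p => e p omega]]); last first.
  by apply/seteqP; split=> omega [lambda l0 lt]; exists lambda => //; move: lt;
    rewrite teE /margin_bound meE.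
apply: measurable_finite_test => -[l [|]] /=; rewrite /e /=.
  rewrite /margin; have -> : gamma R h.+2 = (fine (gamma R h.+2))%:E.
    by rewrite /gamma /=; case: ifP.
  under eq_fun do rewrite lee_fin.
  apply: measurable_fun_ler.
    by apply: measurable_funM; [exact: measurable_g | exact: measurable_Y].
  by apply: measurable_funM => //; apply: measurable_funM => //; exact: measurable_radius.
apply: measurableT_comp => //; apply: measurable_fun_eqr; last exact: measurable_Y.
apply: measurable_funB => //; apply: measurable_funM => //.
rewrite (_ : (fun _ => _) = fun omega : Om => if 0 <= g w b (X omega l) then 1 else 0 : R); last first.
  by apply/funext => omega; case: (0 <= _).
apply: measurable_fun_ifT => //; apply: measurable_fun_ler => //; exact: measurable_g.
Qed.

End Measurability.

Lemma rat_shrink (R : realType) (w delta : R) : 0 < delta ->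
  exists q : rat, `|ratr q| <= `|w| /\ `|ratr q - w| <= delta.
Proof.
move=> d0; have [w0|w0|->] := ltrgt0P w.
- have [q] : exists q : rat, ratr q \in `]Num.max 0 (w - delta), w[.
    by apply: rat_in_itvoo; rewrite gt_max w0 gtrBl.
  rewrite in_itv /= gt_max => /andP[/andP[q0 qd] qw]; exists q.
  rewrite gtr0_norm // (ltW qw); split => //.
  by rewrite ltr0_norm ?subr_lt0 // opprB lerBlDr -lerBlDl ltW.
- have [q] : exists q : rat, ratr q \in `]w, Num.min 0 (w + delta)[.
    by apply: rat_in_itvoo; rewrite lt_min w0 ltrDl.
  rewrite in_itv /= lt_min => /and3P[wq q0 qd]; exists q.
  rewrite ltr0_norm // lerN2 (ltW wq); split => //.
  by rewrite gtr0_norm ?subr_gt0 // lerBlDl ltW.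
- by exists 0; rewrite rmorph0 subr0 normr0; split => //; exact: ltW.
Qed.

Section Perturbation.
Variables (R : realType) (n d : nat) (x : 'I_n -> d.-tuple R).

Lemma rational_hyperplane (w : d.-tuple R) (b eta : R) : 0 < eta ->
  exists (r : d.-tuple rat) (q : rat), enorm (map_tuple ratr r : d.-tuple R) <= enorm w /\
    forall l, g w b (x l) <= g (map_tuple ratr r) (ratr q) (x l) < g w b (x l) + eta.
Proof.
move=> eta0.
pose S : R := 1 + \sum_l \sum_j `|tnth (x l) j|.
have S0 : 0 < S by rewrite ltr_wpDr // sumr_ge0 // => l _; rewrite sumr_ge0.
have xS l : \sum_j `|tnth (x l) j| <= S.
  rewrite /S (bigD1 l) //= addrCA lerDl addr_ge0 // sumr_ge0 // => i _.
  by rewrite sumr_ge0.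
pose theta := eta / 4; have th0 : 0 < theta by rewrite divr_gt0.
have dl0 : 0 < theta / S by rewrite divr_gt0.
have /choice[r rP] := fun j => rat_shrink (tnth w j) dl0.
have [q] : exists q : rat, ratr q \in `](b - 2 * theta), (b - theta)[.
  by apply: rat_in_itvoo; lra.
rewrite in_itv /= => /andP[q1 q2].
exists [tuple r j | j < d], q; split.
  rewrite ler_wsqrtr //; apply: ler_sum => j _; rewrite tnth_map tnth_mktuple.
  have [le _] := rP j.
  by rewrite -[leLHS]real_normK ?num_real // -[leRHS]real_normK ?num_real // lerXn2r ?nnegrE.
move=> l; set r' := map_tuple _ _.
have : `|dotp r' (x l) - dotp w (x l)| <= theta.
  rewrite /dotp -sumrB; apply: le_trans (ler_norm_sum _ _ _) _.
  apply: (@le_trans _ _ (\sum_j theta / S * `|tnth (x l) j|)).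
    apply: ler_sum => j _; rewrite -mulrBl normrM ler_wpM2r //.
    by rewrite tnth_map tnth_mktuple; case: (rP j).
  by rewrite -mulr_sumr mulrAC ler_pdivrMr // ler_pM2l.
rewrite /g ler_norml => /andP[]; rewrite /theta in q1 q2 *; lra.
Qed.

End Perturbation.

Lemma exists_le_all (R : realFieldType) (I : finType) (D : I -> R) :
  exists2 eta, 0 < eta & forall i, 0 < D i -> eta <= D i.
Proof.
exists (\big[Num.min/1]_(i | 0 < D i) D i); last by move=> i Di; exact: bigmin_le_cond.
by apply: lt_bigmin.
Qed.

Lemma sum_level_weights (R : realType) (eps : R) (m : nat) : 0 <= eps ->
  \sum_(h < m) eps / (2 * h.+2%:R * h.+3%:R) <= eps.
Proof.
move=> eps0.
have -> : \sum_(h < m) eps / (2 * h.+2%:R * h.+3%:R) = eps / 2 * (2^-1 - m.+2%:R^-1).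
  elim: m => [|m IH]; first by rewrite big_ord0 subrr mulr0.
  rewrite big_ord_recr /= IH -[m.+3%:R]natr1.
  have : 0 < m.+2%:R :> R by rewrite ltr0n.
  move: (m.+2%:R) => y y0; field.
  by rewrite !gt_eqF // addr_gt0.
have : 0 <= m.+2%:R^-1 :> R by rewrite invr_ge0.
by move: (_^-1) => y y0; nra.
Qed.

Section BadEvent.
Variables (R : realType) (N k d : nat) (eps : R).
Local Notation Om := (Omega R N k d).
Hypotheses (N0 : (0 < N)%N) (k0 : (0 < k)%N) (eps0 : 0 < eps) (eps1 : eps < 1).

Definition bad : set Om := [set omega | exists h (r : d.-tuple rat) (q : rat),
  [/\ (h.+2 <= 4 * (k.+1 * N))%N, enorm (map_tuple ratr r : d.-tuple R) <= 1 &
      violated eps h.+2 (map_tuple ratr r) (ratr q) omega]].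

Lemma measurable_bad : measurable bad.
Proof.
rewrite (_ : bad = \bigcup_(p : nat * (d.-tuple rat * rat)) [set omega |
    ((p.1.+2 <= 4 * (k.+1 * N))%N && (enorm (map_tuple ratr p.2.1 : d.-tuple R) <= 1)) /\
    violated eps p.1.+2 (map_tuple ratr p.2.1) (ratr p.2.2) omega]); last first.
  apply/seteqP; split=> [omega [h [r [q [hn r1 v]]]]|omega [[h [r q]] _ [/andP[hn r1] v]]].
    by exists (h, (r, q)) => //=; rewrite hn r1.
  by exists h, r, q.
apply: countable_bigcupT_measurable => [|[h [r q]] /=]; first exact: countableP.
case: (_ && _); last by rewrite (_ : [set _ | _] = set0) // -subset0 => omega [].
rewrite (_ : [set _ | _] = [set omega | violated eps h.+2 (map_tuple ratr r) (ratr q) omega]).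
  exact: measurable_violated.
by apply/seteqP; split=> omega //= [].
Qed.

Lemma bad_measure (P : probability Om R) : partially_exchangeable P -> (P bad <= eps%:E)%E.
Proof.
move=> exch; apply: (orbit_measure exch measurable_bad (ltW eps0)) => omega.
pose V h := [set a : {ffun 'I_N -> 'I_k.+1} |
  `[< exists w b, enorm w <= 1 /\ violated eps h.+2 w b (act a omega) >]]%SET.
pose m := (4 * (k.+1 * N)).-1.
have hm h : (h < m)%N = (h.+2 <= 4 * (k.+1 * N))%N.
  by rewrite /m -[(4 * _)%N in RHS]prednK // !muln_gt0 N0.
apply: (@le_trans _ _ (\sum_(h < m) #|V h|%:R)).
  rewrite -natr_sum ler_nat; apply: (@leq_trans #|\bigcup_(h < m) V h|%SET); last first.
    elim/big_rec2: _ => [|h s A _ IH]; first by rewrite cards0.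
    by rewrite (leq_trans (leq_card_setU _ _)) // leq_add2l.
  apply/subset_leq_card/fintype.subsetP => a; rewrite finset.in_set => /asboolP.
  move=> [h [r [q [hn r1 v]]]]; rewrite -hm in hn.
  apply/finset.bigcupP; exists (Ordinal hn) => //.
  by rewrite finset.in_set; apply/asboolP; exists (map_tuple ratr r), (ratr q).
apply: (@le_trans _ _ (\sum_(h < m) eps / (2 * h.+2%:R * h.+3%:R) * k.+1%:R ^+ N)).
  by apply: ler_sum => h _; apply: card_violated; rewrite // -hm.
rewrite -mulr_suml; apply: ler_wpM2r; first by rewrite exprn_ge0.
exact/sum_level_weights/ltW.
Qed.

Lemma good_bound omega w b lambda h : ~ bad omega -> enorm w = 1 -> 0 < lambda ->
  (1 <= h <= 4 * (k.+1 * N))%N -> test_error w b omega <= margin_bound eps w b lambda h omega.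
Proof.
move=> good w1 l0 hb; have C0 := complexity_ge0 N0 eps0 eps1 hb.
have te1 := test_error_le1 N0 k0 w b omega.
rewrite -[leRHS]/(deviation N k lambda (complexity N k eps h) (margin_errors w b h omega)).
case: h hb C0 => [|[|h]] //= hb C0.
  rewrite (_ : margin_errors w b 1 omega = N%:R).
    exact: le_trans te1 (deviation_full N0 k0 l0 C0).
  rewrite /margin_errors sum_train (eq_bigr (fun=> 1)) ?sumr_const ?card_ord // => i _.
  by rewrite /margin /gamma /= leey.
have [c [c0 mE _]] := margin_finite omega h.
pose v l := g w b (X omega l).
have [eta1 eta10 eta1P] := exists_le_all (fun l => - v l).
have [eta2 eta20 eta2P] := exists_le_all (fun l => - (4 * c) - v l).
pose eta := Num.min eta1 eta2.
have eta0 : 0 < eta by rewrite lt_min eta10.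
have m1 : eta <= eta1 by rewrite ge_min lexx.
have m2 : eta <= eta2 by rewrite ge_min lexx orbT.
have [r [q [r1 rq]]] := rational_hyperplane (X omega) w b eta0.
set w' : d.-tuple R := map_tuple ratr r in r1 rq; set b' : R := ratr q in rq.
have lt1 l : v l < 0 -> g w' b' (X omega l) < 0.
  move=> vl; have /andP[_] := rq l; have := eta1P l; rewrite oppr_gt0 => /(_ vl).
  by rewrite -/(v l) => le lt; clearbody eta; lra.
have lt2 l : v l < - (4 * c) -> g w' b' (X omega l) < - (4 * c).
  move=> vl; have /andP[_] := rq l; have := eta2P l; rewrite subr_gt0 => /(_ vl).
  by rewrite -/(v l) => le lt; clearbody eta; lra.
have ge l : v l <= g w' b' (X omega l) by have /andP[] := rq l.
have te : test_error w b omega <= test_error w' b' omega.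
  rewrite ler_wpM2l ?invr_ge0 ?mulr_ge0 //; apply: ler_sum => l _.
  suff -> : (0 <= g w b (X omega l)) = (0 <= g w' b' (X omega l)) by [].
  rewrite -/(v l); apply/idP/idP => [v0|]; first exact: le_trans v0 (ge l).
  by apply: contraTT; rewrite -!ltNge; exact: lt1.
have me : margin_errors w' b' h.+2 omega <= margin_errors w b h.+2 omega.
  apply: ler_sum => l _; rewrite mE !lee_fin ler_nat /Y -/(v l).
  suff : (g w' b' (X omega l) * (if (tnth omega l).2 then 1 else -1) <= 4 * c) ->
      (v l * (if (tnth omega l).2 then 1 else -1) <= 4 * c).
    by case: (_ <= _) => // ->.
  case: (tnth omega l).2; first by rewrite !mulr1; apply: le_trans (ge l).
  rewrite !mulrN1 ![_ <= 4 * c]lerNl; apply: contraTT; rewrite -!ltNge; exact: lt2.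
apply: (deviation_mono N0 k0 (m := margin_errors w' b' h.+2 omega) l0 C0 _ te1).
  by rewrite me margin_errors_le.
apply: le_trans te _; rewrite leNgt; apply/negP => v'.
apply: good; exists h, r, q; split; first by [].
  by rewrite -w1.
by exists lambda.
Qed.

End BadEvent.

Theorem theorem4p2p8 (R : realType) (N k d : nat)
    (hN : (0 < N)%N) (hk : (0 < k)%N) (hd : (0 < d)%N)
    (P : probability (Omega R N k d) R) (hP : partially_exchangeable P)
    (eps : R) (heps0 : 0 < eps) (heps1 : eps < 1) :
  exists A : set (Omega R N k d),
    [/\ measurable A,
        ((1 - eps)%:E <= P A)%E &
        forall omega : Omega R N k d, A omega ->
        forall (w : d.-tuple R) (b : R), enorm w = 1 ->
          ((test_error w b omega)%:E <=
           ereal_inf [set r : \bar R | exists (lambda : R) (h : nat),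
             [/\ (0 < lambda)%R, (1 <= h <= 4 * (k.+1 * N))%N &
                 r = (margin_bound eps w b lambda h omega)%:E]])%E].
Proof.
have mB := @measurable_bad R N k d eps.
exists (~` @bad R N k d eps); split.
- exact: measurableC.
- rewrite probability_setC // EFinB leeB //.
  exact: bad_measure.
- move=> omega good w b w1; apply: le_ereal_inf_tmp => _ [lambda [h [l0 hb ->]]].
  by rewrite lee_fin; apply: good_bound.
Qed.
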